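(* The data $(U_-,X)$ are informative for stabilization by state feedback if and only if there exists a matrix $\Theta\in\mathbb{R}^{T\times n}$ satisfying $$X_-\Theta=(X_-\Theta)^\top\quad\text{and}\quad\begin{bmatrix}X_-\Theta & X_+\Theta \\ \Theta^\top X_+^\top & X_-\Theta\end{bmatrix}>0.\qquad( * )$$ Moreover, $K\in\mathbb{R}^{m\times n}$ satisfies $\Sigma_{i/s}\subseteq\Sigma_K$ if and only if $K=U_-\Theta(X_-\Theta)^{-1}$ for some matrix $\Theta\in\mathbb{R}^{T\times n}$ satisfying $( * )$.
   Context: Fix positive integers $n,m,q,T_1,\dots,T_q$ and put $T=T_1+\cdots+T_q$. Let $(A_s,B_s)\in\mathbb{R}^{n\times n}\times\mathbb{R}^{n\times m}$ be the 'true' system $x(t+1)=A_sx(t)+B_su(t)$. For $i=1,\dots,q$ let $u^i(0),\dots,u^i(T_i-1)\in\mathbb{R}^m$ and $x^i(0),\dots,x^i(T_i)\in\mathbb{R}^n$ be input/state data generated by this system, i.e. $x^i(t+1)=A_sx^i(t)+B_su^i(t)$ for $t=0,\dots,T_i-1$. Put $U^i_-=[u^i(0)\ \cdots\ u^i(T_i-1)]$, $X^i=[x^i(0)\ \cdots\ x^i(T_i)]$, $X^i_-=[x^i(0)\ \cdots\ x^i(T_i-1)]$, $X^i_+=[x^i(1)\ \cdots\ x^i(T_i)]$, and $U_-=[U^1_-\ \cdots\ U^q_-]$, $X=[X^1\ \cdots\ X^q]$, $X_-=[X^1_-\ \cdots\ X^q_-]$, $X_+=[X^1_+\ \cdots\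 X^q_+]$; thus $X_+=A_sX_-+B_sU_-$ and $U_-,X_-,X_+$ have $T$ columns. The set of systems consistent with the data is $$\Sigma_{i/s}=\Big\{(A,B)\in\mathbb{R}^{n\times n}\times\mathbb{R}^{n\times m}\ \Big|\ X_+=\begin{bmatrix}A & B\end{bmatrix}\begin{bmatrix}X_- \\ U_- \end{bmatrix}\Big\}.$$ A square matrix is stable if all its eigenvalues lie in the open unit disk. For $K\in\mathbb{R}^{m\times n}$, $\Sigma_K=\{(A,B)\mid A+BK\text{ is stable}\}$. The data are informative for stabilization by state feedback if there exists $K$ with $\Sigma_{i/s}\subseteq\Sigma_K$. For a symmetric matrix, $>0$ means positive definite. *)

(* Defs.v *)
From HB Require Import structures.
From mathcomp Require Import all_boot all_order all_algebra.
From mathcomp Require Import boolp classical_sets reals.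
From mathcomp Require Import complex.

Set Implicit Arguments.
Unset Strict Implicit.
Unset Printing Implicit Defensive.

Import Order.TTheory GRing.Theory Num.Theory.
Local Open Scope classical_set_scope.
Local Open Scope ring_scope.
Local Open Scope complex_scope.

(* The eigenvalues are the complex ones. [eigenvalue] refers to row vectors,
   which yields the same spectrum as column vectors. *)
Definition stable (R : realType) (n : nat) (A : 'M[R]_n) : Prop :=
  forall z : R[i], eigenvalue (map_mx (real_complex R) A) z -> `|z| < 1.

Definition posdef (R : realType) (n : nat) (M : 'M[R]_n) : Prop :=
  M^T = M /\ forall v : 'cV[R]_n, v != 0 -> 0 < (v^T *m M *m v) ord0 ord0.

(* Trajectory i has T i inputs u i 0, ..., u i (T i - 1) and T i + 1 states
   x i 0, ..., x i (T i). *)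
Definition inputs (R : realType) (m q : nat) (T : 'I_q -> nat) :=
  forall i : 'I_q, 'I_(T i) -> 'cV[R]_m.

Definition states (R : realType) (n q : nat) (T : 'I_q -> nat) :=
  forall i : 'I_q, 'I_(T i).+1 -> 'cV[R]_n.

Definition generated_by (R : realType) (n m q : nat) (T : 'I_q -> nat)
    (A : 'M[R]_n) (B : 'M[R]_(n, m))
    (u : inputs R m T) (x : states R n T) : Prop :=
  forall (i : 'I_q) (t : 'I_(T i)),
    x i (lift ord0 t) = A *m x i (widen_ord (leqnSn (T i)) t) + B *m u i t.

Definition Uminus (R : realType) (m q : nat) (T : 'I_q -> nat)
    (u : inputs R m T) : 'M[R]_(m, \sum_(i < q) T i) :=
  \mxrow_(i < q) \matrix_(k < m, t < T i) u i t k ord0.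

Definition Xminus (R : realType) (n q : nat) (T : 'I_q -> nat)
    (x : states R n T) : 'M[R]_(n, \sum_(i < q) T i) :=
  \mxrow_(i < q)
    \matrix_(k < n, t < T i) x i (widen_ord (leqnSn (T i)) t) k ord0.

(* [lift ord0 t] is t + 1 in 'I_(T i).+1. *)
Definition Xplus (R : realType) (n q : nat) (T : 'I_q -> nat)
    (x : states R n T) : 'M[R]_(n, \sum_(i < q) T i) :=
  \mxrow_(i < q) \matrix_(k < n, t < T i) x i (lift ord0 t) k ord0.

Definition Sigma_is (R : realType) (n m q : nat) (T : 'I_q -> nat)
    (u : inputs R m T) (x : states R n T) : set ('M[R]_n * 'M[R]_(n, m)) :=
  [set AB | Xplus x = row_mx AB.1 AB.2 *m col_mx (Xminus x) (Uminus u)].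

Definition Sigma_K (R : realType) (n m : nat) (K : 'M[R]_(m, n)) :
    set ('M[R]_n * 'M[R]_(n, m)) :=
  [set AB | stable (AB.1 + AB.2 *m K)].

Definition informative_state_feedback (R : realType) (n m q : nat)
    (T : 'I_q -> nat) (u : inputs R m T) (x : states R n T) : Prop :=
  exists K : 'M[R]_(m, n), Sigma_is u x `<=` Sigma_K K.

Definition feedback_lmi (R : realType) (n q : nat) (T : 'I_q -> nat)
    (x : states R n T) (Theta : 'M[R]_(\sum_(i < q) T i, n)) : Prop :=
  Xminus x *m Theta = (Xminus x *m Theta)^T /\
  posdef (block_mx (Xminus x *m Theta)      (Xplus x *m Theta)
                   (Theta^T *m (Xplus x)^T) (Xminus x *m Theta)).

(* Main.v *)
Require Import Defs.
From HB Require Import structures.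
From mathcomp Require Import all_boot all_order all_algebra.
From mathcomp Require Import boolp classical_sets reals.
From mathcomp Require Import complex.
From mathcomp Require Import topology normedtype sequences.
From mathcomp Require Import ring lra.

(* If Theta satisfies the linear matrix inequality, put P := X_- Theta and
   K := U_- Theta P^-1.  Every consistent (A, B) satisfies
   X_+ Theta = (A + B K) P, so by a Schur complement the inequality says that P
   is a Lyapunov certificate of A + B K.
   Conversely, let K stabilize all consistent systems.  If (A0, B0) annihilates
   the data, then (A_s + B_s K) + a (A0 + B0 K) is stable for every real a; the
   trace of a stable matrix is at most n, so A0 + B0 K has trace zero.
   Applying this to the left multiples of (A0, B0) gives A0 + B0 K = 0, hence
   there is G with X_- G = 1 and U_- G = K.  Then X_+ G = A_s + B_s K is stable,
   and Theta := G P works for any Lyapunov certificate P of it. *)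

Set Implicit Arguments.
Unset Strict Implicit.
Unset Printing Implicit Defensive.

Import Order.TTheory GRing.Theory Num.Theory.
Import numFieldNormedType.Exports.
Local Open Scope classical_set_scope.
Local Open Scope ring_scope.

(** * Convergence to zero of the powers of a stable matrix *)

Lemma contraction_cvg0 (R : realType) (r : R) (a b : nat -> R) :
    0 <= r < 1 -> (forall k, 0 <= a k) ->
    (forall k, a k.+1 <= r * a k + b k) ->
  b @ \oo --> 0 -> a @ \oo --> 0.
Proof.
move=> /andP[r0 r1] a0 ab /cvgr0Pnorm_le b0; apply/cvgr0Pnorm_le => e e0.
(* The bound [e * (1 - r) / 2] makes [e / 2] the fixed point of the affine recursion, so beyond it
   only the transient [r ^+ j * a N] remains. *)
have /b0[N _ bN] : 0 < e * (1 - r) / 2 by rewrite divr_gt0 ?mulr_gt0 ?subr_gt0.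
have aN j : a (N + j)%N <= r ^+ j * a N + e / 2.
  elim: j => [|j IH]; first by rewrite addn0 expr0 mul1r lerDl divr_ge0 ?ltW.
  rewrite addnS (le_trans (ab _))// exprS.
  have := ler_wpM2l r0 IH; have := le_trans (ler_norm _) (bN _ (leq_addr j N)).
  by lra.
(* Since [a N] may vanish, the division below is by [a N + 1]. *)
have aN0 : 0 < a N + 1 by rewrite ltr_wpDl.
have /cvgr0Pnorm_le/(_ (e / 2 / (a N + 1))) : GRing.exp r @ \oo --> 0.
  by apply: cvg_expr; rewrite ger0_norm.
rewrite !divr_gt0// => /(_ isT).
move=> [J _ rJ]; exists (N + J)%N => //= k /= NJk.
have Nk : (N <= k)%N := leq_trans (leq_addr _ _) NJk.
rewrite ger0_norm// -(subnKC Nk) (le_trans (aN _))//.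
have /rJ : (J <= k - N)%N by rewrite leq_subRL.
rewrite /= => /(le_trans (ler_norm _)); rewrite ler_pdivlMr//.
have := exprn_ge0 (k - N) r0; set t := r ^+ _; move: (a N) => ? ? ?; lra.
Qed.

(* Peels one factor off the characteristic polynomial: f k := A ^+ k * D
   satisfies f k.+1 - z *: f k = A ^+ k * (A - z%:M) * D. *)
Lemma powers_cvg0_peel (R : realType) (n : nat) (A D : 'M[R[i]]_n.+1) z :
    `|z| < 1 ->
    (forall i j, Normc.normc ((A ^+ k * (A - z%:M) * D) i j) @[k --> \oo] --> 0) ->
  forall i j, Normc.normc ((A ^+ k * D) i j) @[k --> \oo] --> 0.
Proof.
move=> z1 ADcvg i j.
apply: (contraction_cvg0 (r := Normc.normc z) _ _ _ (ADcvg i j)).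
- rewrite -ltcR -[(Normc.normc z)%:C%C]/`|z| z1 andbT.
  by case: z {z1 ADcvg} => x y; rewrite sqrtr_ge0.
- by move=> k; case: (_ i j) => x y; rewrite sqrtr_ge0.
move=> k; rewrite mulrBr -exprSr mulrBl.
have Az : (A ^+ k * z%:M * D) i j = z * (A ^+ k * D) i j.
  by rewrite [A ^+ k * _]mul_mx_scalar -scalerAl mxE.
rewrite -{1}(subrKC (A ^+ k * z%:M * D) (A ^+ k.+1 * D)) mxE Az.
by rewrite (le_trans (le_normcD _ _))// Normc.normcM.
Qed.

(** By Cayley-Hamilton the product of the factors [A - z%:M] over the roots of the characteristic
    polynomial is zero. Peeling off these factors one at a time carries convergence from the zero
    sequence to the powers themselves. *)
Lemma stable_powers_cvg0 (R : realType) (n : nat) (M : 'M[R]_n.+1) :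
  stable M -> forall i j, (M ^+ k) i j @[k --> \oo] --> 0.
Proof.
move=> Mst; pose A := map_mx (real_complex R) M.
have [rs /eqP] := closed_field_poly_normal (char_poly A).
rewrite (monicP (char_poly_monic A)) scale1r => /eqP Ars.
have rs1 : all (fun z => `|z| < 1) rs.
  apply/allP => z zrs; apply: Mst.
  by rewrite eigenvalue_root_char Ars root_prod_XsubC.
have peel (D : 'M_n.+1) : all (fun z => `|z| < 1) rs ->
    (forall i j, Normc.normc ((A ^+ k * (\prod_(z <- rs) (A - z%:M)) * D) i j)
      @[k --> \oo] --> 0) ->
    forall i j, Normc.normc ((A ^+ k * D) i j) @[k --> \oo] --> 0.
  elim: rs {Ars rs1} D => [|z rs IH] D.
    by move=> _ + i j => /(_ i j); under eq_fun do rewrite big_nil mulr1.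
  move=> /= /andP[z1 rs1] Acvg; apply: (IH _ rs1) => i j.
  under eq_fun do rewrite -mulrA.
  apply: (powers_cvg0_peel z1) => i' j'.
  apply: cvg_trans (Acvg i' j'); apply/near_eq_cvg/nearW => k /=.
  by rewrite big_cons !mulrA.
have Aprod : \prod_(z <- rs) (A - z%:M) = 0.
  rewrite -(Cayley_Hamilton A) Ars rmorph_prod; apply: eq_bigr => z _.
  by rewrite rmorphB /= horner_mx_X horner_mx_C.
move=> i j; apply/cvgr0Pnorm_le => e e0.
have /peel : all (fun z => `|z| < 1) rs by [].
move=> /(_ 1); rewrite Aprod => /(_ _ i j) Acvg.
have {Acvg}/cvgr0Pnorm_le/(_ e e0) :
    Normc.normc ((A ^+ k * 1) i j) @[k --> \oo] --> 0.
  apply: Acvg => i' j'.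
  under eq_fun do rewrite mulr0 mul0r mxE Normc.normc0.
  exact: cvg_cst.
apply: filterS => k; rewrite mulr1 -rmorphXn/= mxE /=.
by rewrite expr0n/= addr0 sqrtr_sqr normr_id.
Qed.

(** * Positive definite forms and Lyapunov certificates *)

Lemma sqnorm_ge0 (R : realDomainType) (n : nat) (v : 'cV[R]_n) :
  0 <= (v^T *m v) ord0 ord0.
Proof. by rewrite mxE sumr_ge0 // => i _; rewrite mxE -expr2 sqr_ge0. Qed.

Lemma sqnorm_gt0 (R : realDomainType) (n : nat) (v : 'cV[R]_n) :
  v != 0 -> 0 < (v^T *m v) ord0 ord0.
Proof.
move=> v0; rewrite lt_def sqnorm_ge0 andbT; apply: contraNneq v0 => vv0.
apply/eqP/colP => i; rewrite mxE; apply/eqP; rewrite -sqrf_eq0; apply/eqP.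
move: vv0; rewrite mxE => /psumr_eq0P -/(_ _ i isT).
by rewrite mxE -expr2; apply => j _; rewrite mxE -expr2 sqr_ge0.
Qed.

(** Bounding [|x y|] by [(x^2 + y^2) / 2] in each term of [v^T S v] yields at most [d * n%:R] times
    the squared norm of [v]. *)
Lemma posdef_scalar1B (R : realType) (n : nat) (S : 'M[R]_n) (d : R) :
    S^T = S -> (forall i j, `|S i j| <= d) -> d * n%:R < 1 ->
  posdef (1%:M - S).
Proof.
move=> Ssym Sd dn; split=> [|v v0].
  by rewrite linearB /= trmx1 Ssym.
rewrite mulmxBr mulmx1 mulmxBl !mxE subr_gt0.
pose s := \sum_i v i ord0 ^+ 2.
have s0 : 0 < s.
  have := sqnorm_gt0 v0; rewrite mxE; congr (_ < _).
  by apply: eq_bigr => i _; rewrite mxE expr2.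
have -> : \sum_j v^T ord0 j * v j ord0 = s.
  by apply: eq_bigr => i _; rewrite mxE expr2.
apply: le_lt_trans (_ : d * n%:R * s < s); last by rewrite gtr_pMl.
have -> : d * n%:R * s =
    \sum_j \sum_i d * (v i ord0 ^+ 2 + v j ord0 ^+ 2) / 2.
  have sumc c : \sum_(i < n) c = n%:R * c :> R.
    by rewrite sumr_const card_ord mulr_natl.
  under eq_bigr => j _ do
    rewrite -mulr_suml -mulr_sumr big_split /= sumc -/s.
  by rewrite -mulr_suml -mulr_sumr big_split /= sumc -mulr_sumr -/s; field.
apply: ler_sum => j _; rewrite mxE mulr_suml; apply: ler_sum => i _; rewrite mxE.
set x := v i ord0; set y := v j ord0; have := Sd i j; set t := S i j => td.
apply: le_trans (ler_norm _) _; rewrite mulrAC normrM mulrC.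
apply: le_trans (ler_wpM2r (normr_ge0 _) td) _.
rewrite -mulrA ler_wpM2l ?(le_trans _ td)// normrM.
have := sqr_ge0 (`|x| - `|y|); rewrite -(real_normK (num_real x)).
rewrite -(real_normK (num_real y)); lra.
Qed.

Lemma stable_lyapunov (R : realType) (n : nat) (M : 'M[R]_n.+1) :
    stable M ->
  exists P : 'M[R]_n.+1, posdef P /\ posdef (P - M *m P *m M^T).
Proof.
move=> /stable_powers_cvg0 Mcvg.
(* For size n + 1 the entries of [M ^+ N *m (M ^+ N)^T] are at most [(n + 1) e^2], and this [e]
   gives [(n + 1)^2 e^2 = (1 - e)^2 < 1]. *)
pose e : R := n.+2%:R^-1.
have e0 : 0 < e by rewrite invr_gt0 ltr0n.
have [N MN] : exists N, forall i j, `|(M ^+ N) i j| <= e.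
  have {}Mcvg i j : \forall k \near \oo, `|(M ^+ k) i j| <= e.
    by have /cvgr0Pnorm_le/(_ e e0) := Mcvg i j.
  have [N _ MN] : \forall k \near \oo, forall i j, `|(M ^+ k) i j| <= e.
    by apply: filter_forall => i; apply: filter_forall => j; apply: Mcvg.
  by exists N; apply: MN; apply: leqnn.
(* The truncated Lyapunov series: P - M P M^T telescopes to 1 - M^N (M^N)^T,
   which is positive definite once the entries of M^N are small. *)
pose P := \sum_(k < N) M ^+ k *m (M ^+ k)^T.
have Ptelescope : P - M *m P *m M^T = 1%:M - M ^+ N *m (M ^+ N)^T.
  apply/eqP; rewrite subr_eq addrAC eq_sym subr_eq; apply/eqP.
  rewrite /P; elim: N {MN P} => [|N IH].
    by rewrite !big_ord0 mulmx0 mul0mx expr0 trmx1 mulmx1 addr0 add0r.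
  rewrite !big_ord_recr /= mulmxDr mulmxDl addrA IH; congr (_ + _).
  by rewrite !exprS -mulmxE trmx_mul !mulmxA.
have Psym : P^T = P.
  by rewrite linear_sum; apply: eq_bigr => k _; rewrite /= trmx_mul trmxK.
have Ppsd (v : 'cV_n.+1) : 0 <= (v^T *m P *m v) ord0 ord0.
  rewrite mulmx_sumr mulmx_suml summxE sumr_ge0// => k _.
  by have := sqnorm_ge0 ((M ^+ k)^T *m v); rewrite trmx_mul trmxK !mulmxA.
have PMpd : posdef (P - M *m P *m M^T).
  rewrite Ptelescope; apply: (posdef_scalar1B (d := n.+1%:R * e ^+ 2)).
  - by rewrite trmx_mul trmxK.
  - move=> i j; rewrite mxE (le_trans (ler_norm_sum _ _ _))//.
    rewrite [leRHS]mulr_natl -[X in _ *+ X]card_ord -sumr_const ler_sum// => k _.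
    by rewrite mxE normrM expr2 ler_pM.
  have -> : n.+1%:R = e^-1 - 1 :> R by rewrite /e invrK -(natr1 n.+1) addrK.
  have e1 : 0 < 1 - e by rewrite subr_gt0 invf_lt1 ?ltr0n// ltr1n.
  have -> : (e^-1 - 1) * e ^+ 2 * (e^-1 - 1) = (1 - e) ^+ 2.
    by field; rewrite gt_eqF.
  by rewrite expr_lt1// ?ltW// gtrBl.
exists P; split=> //; split=> // v v0.
(* As a sum of Gram matrices [P] is a priori only semidefinite; strictness comes from
   [P - M P M^T]. *)
have := PMpd.2 v v0; rewrite mulmxBr mulmxBl mxE [X in _ + X]mxE subr_gt0.
apply: le_lt_trans.
by have := Ppsd (M^T *m v); rewrite trmx_mul trmxK !mulmxA.
Qed.

(** With [v = a^T + i b^T] the cross terms cancel by the symmetry of [P], which leaves the sum of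
    the real forms at [a] and [b], not both zero. *)
Lemma posdef_complex (R : realType) (n : nat) (P : 'M[R]_n) (v : 'rV[R[i]]_n) :
    posdef P -> v != 0 ->
  0 < (v *m map_mx (real_complex R) P *m (map_mx conjc v)^T) ord0 ord0.
Proof.
move=> [Psym Ppd] v0.
pose a : 'cV[R]_n := \col_i complex.Re (v ord0 i).
pose b : 'cV[R]_n := \col_i complex.Im (v ord0 i).
have -> : (v *m map_mx (real_complex R) P *m (map_mx conjc v)^T) ord0 ord0 =
    ((a^T *m P *m a) ord0 ord0 + (b^T *m P *m b) ord0 ord0)%:C%C.
  have abba : a^T *m P *m b = b^T *m P *m a.
    have <- : (b^T *m P *m a)^T = a^T *m P *m b.
      by rewrite !trmx_mul trmxK Psym mulmxA.
    by apply/matrixP => i j; rewrite [LHS]mxE !ord1.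
  have vE : v = (map_mx (real_complex R) a)^T
      + 'i%C *: (map_mx (real_complex R) b)^T.
    by apply/rowP => i; rewrite !mxE -complexE.
  have vJ : (map_mx conjc v)^T = map_mx (real_complex R) a
      - 'i%C *: map_mx (real_complex R) b.
    apply/colP => i; rewrite !mxE; case: (v ord0 i) => x y /=.
    by apply/eqP; rewrite eq_complex /=; apply/andP; split; apply/eqP; ring.
  rewrite vJ vE !map_trmx mulmxDl -scalemxAl mulmxBr !mulmxDl -!scalemxAr.
  rewrite -!scalemxAl -!map_mxM scalerA -expr2 sqr_i.
  rewrite abba scaleN1r opprD opprK addrA addrK -map_mxD mxE.
  by congr (_%:C%C); rewrite mxE.
have Pge0 (w : 'cV_n) : 0 <= (w^T *m P *m w) ord0 ord0.
  have [->|/Ppd/ltW//] := eqVneq w 0.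
  by rewrite mulmx0 mxE.
rewrite (ltcR 0); have [a0|a0] := eqVneq a 0.
  rewrite ltr_wpDl// Ppd//; apply: contraNneq v0 => b0.
  apply/eqP/rowP => i; rewrite mxE; apply/eqP; rewrite eq_complex.
  have /colP/(_ i) := a0; have /colP/(_ i) := b0.
  by rewrite !mxE => -> ->; rewrite !eqxx.
by rewrite ltr_pwDl// Ppd.
Qed.

(** At a left eigenvector for [z] the Hermitian form of [P - M P M^T] is [1 - |z|^2] times that of
    [P], and both are positive. *)
Lemma lyapunov_stable (R : realType) (n : nat) (M P : 'M[R]_n) :
  posdef P -> posdef (P - M *m P *m M^T) -> stable M.
Proof.
move=> Ppd Spd z /eigenvalueP[v vM v0].
have := posdef_complex Spd v0; have := posdef_complex Ppd v0.
rewrite map_mxB !map_mxM mulmxBr mulmxBl !mulmxA vM.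
have -> : z *: v *m map_mx (real_complex R) P *m map_mx (real_complex R) M^T
      *m (map_mx conjc v)^T =
    (z * conjc z) *: (v *m map_mx (real_complex R) P *m (map_mx conjc v)^T).
  rewrite -!scalemxAl -mulmxA.
  have -> : map_mx (real_complex R) M^T *m (map_mx conjc v)^T =
      conjc z *: (map_mx conjc v)^T.
    rewrite -map_trmx -trmx_mul -linearZ /=; congr (_^T).
    rewrite -map_mxZ -vM map_mxM; congr (_ *m _).
    by apply/matrixP => i j; rewrite !mxE /= oppr0.
  by rewrite -scalemxAr scalerA.
have subE (X : 'M[R[i]]_1) c :
    (X - c *: X) ord0 ord0 = X ord0 ord0 - c * X ord0 ord0.
  by rewrite !mxE.
rewrite subE -sqr_normc.
move=> vPv; rewrite subr_gt0 gtr_pMl// => z1.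
by rewrite -(@expr_lt1 _ 2).
Qed.

(** * Traces of stable matrices *)

(** Compare the subleading coefficients of the characteristic polynomial and of its product of
    linear factors. *)
Lemma trace_sum_eigenvalues (F : closedFieldType) (n : nat) (A : 'M[F]_n.+1) :
  exists2 rs : seq F, size rs = n.+1 /\ all (eigenvalue A) rs &
    \tr A = \sum_(z <- rs) z.
Proof.
have [rs /eqP] := closed_field_poly_normal (char_poly A).
rewrite (monicP (char_poly_monic A)) scale1r => /eqP Ars.
have szrs : size rs = n.+1.
  by apply: succn_inj; rewrite -(size_char_poly A) Ars size_prod_XsubC.
exists rs; first split=> //.
  by apply/allP => z zrs; rewrite eigenvalue_root_char Ars root_prod_XsubC.
apply: oppr_inj; rewrite -char_poly_trace// Ars -szrs coefPn_prod_XsubC//.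
by rewrite szrs.
Qed.

Lemma stable_trace_le (R : realType) (n : nat) (A : 'M[R]_n.+1) :
  stable A -> \tr A <= n.+1%:R.
Proof.
move=> Ast.
have [rs [szrs rsA] trA] := trace_sum_eigenvalues (map_mx (real_complex R) A).
rewrite -lecR rmorph_nat; have <- := trace_map_mx (real_complex R) A.
rewrite trA; apply: le_trans (_ : `|\sum_(z <- rs) z| <= _).
  by rewrite -trA trace_map_mx real_ler_norm// complex_real.
rewrite (le_trans (ler_norm_sum _ _ _))// -szrs.
elim: rs {szrs trA} rsA => [|z rs IH]; first by rewrite big_nil.
move=> /= /andP[/Ast/ltW z1 /IH rs1]; rewrite big_cons.
by rewrite -[(size rs).+1]add1n natrD lerD.
Qed.

Lemma stable_ray_trace0 (R : realType) (n : nat) (M N : 'M[R]_n.+1) :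
  (forall a : R, stable (M + a *: N)) -> \tr N = 0.
Proof.
move=> st; apply/eqP/negP => /negP N0.
(* This parameter makes the trace n + 2, one above the bound n + 1. *)
have := stable_trace_le (st ((n.+1%:R + 1 - \tr M) / \tr N)).
rewrite linearD linearZ /= divfK// [\tr M + _]addrC subrK.
by rewrite gerDl ler10.
Qed.

Lemma trace_gram_eq0 (R : realType) (p n : nat) (A : 'M[R]_(p, n)) :
  \tr (A^T *m A) = 0 -> A = 0.
Proof.
rewrite /mxtrace => trA.
have AA j : (A^T *m A) j j = \sum_i A i j ^+ 2.
  by rewrite mxE; apply: eq_bigr => i _; rewrite mxE expr2.
have sum0 j : (A^T *m A) j j = 0.
  move: trA => /psumr_eq0P; apply => // k _.
  by rewrite AA sumr_ge0// => i _; rewrite sqr_ge0.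
apply/matrixP => i j; rewrite mxE; apply/eqP; rewrite -sqrf_eq0; apply/eqP.
move: (sum0 j); rewrite AA => /psumr_eq0P; apply => // k _.
exact: sqr_ge0.
Qed.

(** * Block matrices and the Schur complement *)

Lemma posdef_ulblock (R : realType) (n1 n2 : nat) (A : 'M[R]_n1)
    (B : 'M[R]_(n1, n2)) (C : 'M[R]_(n2, n1)) (D : 'M[R]_n2) :
  posdef (block_mx A B C D) -> posdef A.
Proof.
move=> [+ Bpd]; rewrite tr_block_mx => /eq_block_mx[Asym _ _ _].
split=> // v v0; have := Bpd (col_mx v 0).
rewrite tr_col_mx mul_row_block mul_row_col mulmx0 addr0 trmx0 !mul0mx !addr0.
by apply; rewrite col_mx_eq0 negb_and v0.
Qed.

(** [P - M P M^T] is the Schur complement of the lower right block, since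
    [(M P) P^-1 (M P)^T = M P M^T]. *)
Lemma posdef_block_lyapunov (R : realType) (n : nat) (P M : 'M[R]_n) :
    P^T = P ->
  posdef (block_mx P (M *m P) (M *m P)^T P) <->
  posdef P /\ posdef (P - M *m P *m M^T).
Proof.
move=> Psym.
pose q (w : 'cV[R]_n) := (w^T *m P *m w) ord0 ord0.
pose s (w : 'cV[R]_n) := (w^T *m (P - M *m P *m M^T) *m w) ord0 ord0.
(* Completion of the square in the lower component. *)
have qE (a b : 'cV[R]_n) :
    ((col_mx a b)^T *m block_mx P (M *m P) (M *m P)^T P *m col_mx a b) ord0 ord0
    = q (b + M^T *m a) + s a.
  rewrite /q /s; have -> (X Y : 'M[R]_1) : X ord0 ord0 + Y ord0 ord0 =
      (X + Y) ord0 ord0 by rewrite mxE.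
  congr (fun_of_matrix _ _ _).
  rewrite tr_col_mx mul_row_block mul_row_col [(b + _)^T]linearD /= !trmx_mul.
  rewrite Psym trmxK !(mulmxDl, mulmxDr, mulmxN, mulNmx) !mulmxA.
  rewrite -[RHS]addrA [X in _ = _ + X]addrACA subrr addr0 [RHS]addrC.
  by congr (_ + _); rewrite addrC.
split=> [/[dup] /posdef_ulblock Ppd [_ Bpd]|[[_ Ppd] [_ Spd]]].
  split=> //; split=> [|v v0]; first by rewrite linearB /= !trmx_mul trmxK Psym mulmxA.
  (* This lower component annihilates the completed square and leaves [s v]. *)
  have := Bpd (col_mx v (- (M^T *m v))); rewrite qE addNr /q mulmx0 mxE add0r.
  by apply; rewrite col_mx_eq0 negb_and v0.
have q_ge0 w : 0 <= q w.
  by have [->|/Ppd/ltW//] := eqVneq w 0; rewrite /q mulmx0 mxE.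
split=> [|v]; first by rewrite tr_block_mx Psym trmxK.
rewrite -[v]vsubmxK qE; set a := usubmx v; set b := dsubmx v.
have [->|a0 _] := eqVneq a 0; last by rewrite ltr_wpDl// Spd.
rewrite col_mx_eq0 eqxx /= mulmx0 addr0 => /Ppd.
by rewrite /s mulmx0 [X in _ + X]mxE addr0.
Qed.

(** * From stabilizing gains to the matrix inequality and back *)

(** The column space of [W] is cut out by its left annihilators; the single matrix
    [Y := (cokermx W^T)^T] already tests membership. *)
Lemma left_kernel_factor (F : fieldType) (k l p : nat)
    (W : 'M[F]_(k, l)) (C : 'M[F]_(k, p)) :
  (forall Y : 'M[F]_k, Y *m W = 0 -> Y *m C = 0) -> exists G, W *m G = C.
Proof.
move=> kerWC; suff /submxP[D CD] : (C^T <= W^T)%MS.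
  by exists D^T; rewrite -[RHS]trmxK CD trmx_mul trmxK.
rewrite submxE; apply/eqP/trmx_inj; rewrite trmx0 trmx_mul trmxK.
by apply: kerWC; apply: trmx_inj; rewrite trmx_mul trmxK trmx0 mulmx_coker.
Qed.

Lemma posdef_unitmx (R : realType) (n : nat) (P : 'M[R]_n) :
  posdef P -> P \in unitmx.
Proof.
move=> [Psym Ppd]; rewrite -row_free_unit -kermx_eq0; apply/rowV0P => v.
move=> /sub_kermxP vP; apply/eqP/negP => /negP v0.
suff /Ppd : v^T != 0 by rewrite trmxK vP mul0mx mxE ltxx.
by apply: contra_neq v0 => /(congr1 trmx); rewrite trmxK trmx0.
Qed.

Lemma stabilizing_right_inverse (R : realType) (n m l : nat)
    (Xm Xp : 'M[R]_(n.+1, l)) (Um : 'M[R]_(m, l))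
    (As : 'M[R]_n.+1) (Bs : 'M[R]_(n.+1, m)) (K : 'M[R]_(m, n.+1)) :
    (forall A B, Xp = row_mx A B *m col_mx Xm Um -> stable (A + B *m K)) ->
    Xp = row_mx As Bs *m col_mx Xm Um ->
  exists G, Xm *m G = 1%:M /\ Um *m G = K.
Proof.
move=> Kst Xp_s.
suff /left_kernel_factor[G] : forall Y : 'M_(n.+1 + m),
    Y *m col_mx Xm Um = 0 -> Y *m col_mx 1%:M K = 0.
  by rewrite mul_col_mx => /eq_col_mx; exists G.
(* With [C := col_mx 1%:M K], the Gram matrix of [Y C] is [Z C] for [Z := (Y C)^T Y], so [Y C = 0]
   reduces to a vanishing trace. *)
move=> Y YW; apply: trace_gram_eq0.
(* The rows of Z are left annihilators of the data like those of Y, but Z has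
   n rows, so it is a direction along which the consistent systems recede. *)
rewrite mulmxA; set Z := (_^T *m Y).
have ZW : Z *m col_mx Xm Um = 0 by rewrite -mulmxA YW mulmx0.
rewrite -[Z]hsubmxK in ZW *; rewrite mul_row_col mulmx1.
apply: (@stable_ray_trace0 _ _ (As + Bs *m K)) => a.
rewrite scalerDr addrACA scalemxAl -mulmxDl; apply: Kst.
by rewrite -add_row_mx -scale_row_mx mulmxDl -scalemxAl ZW scaler0 addr0.
Qed.

Lemma generated_by_Sigma_is (R : realType) (n m q : nat) (T : 'I_q -> nat)
    (A : 'M[R]_n) (B : 'M[R]_(n, m)) (u : inputs R m T) (x : states R n T) :
  generated_by A B u x -> Sigma_is u x (A, B).
Proof.
move=> xE; rewrite /Sigma_is /= mul_row_col !mul_mxrow -mxrowD.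
apply/eq_mxrow => i; apply/matrixP => k t; rewrite !mxE xE !mxE.
by congr (_ + _); apply: eq_bigr => j _; rewrite !mxE.
Qed.

Lemma Sigma_K_lmi (R : realType) (n m q : nat) (T : 'I_q -> nat)
    (As : 'M[R]_n) (Bs : 'M[R]_(n, m)) (u : inputs R m T) (x : states R n T)
    (K : 'M[R]_(m, n)) :
    (0 < n)%N -> generated_by As Bs u x ->
  Sigma_is u x `<=` Sigma_K K <->
  exists Theta : 'M[R]_(\sum_(i < q) T i, n),
    feedback_lmi x Theta /\
    K = Uminus u *m Theta *m invmx (Xminus x *m Theta).
Proof.
case: n => // n in As Bs x K * => _ /generated_by_Sigma_is Ss.
rewrite /feedback_lmi; split=> [Kst|[Theta [[Psym Bpd] KE]] [A B] AB].
  have [G [XG UG]] := stabilizing_right_inverse (fun A B => Kst (A, B)) Ss.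
  have [P [Ppd Spd]] := stable_lyapunov (Kst _ Ss).
  have XpG : Xplus x *m G = As + Bs *m K.
    by rewrite Ss /= -mulmxA mul_col_mx XG UG mul_row_col mulmx1.
  (* This choice gives [X_- Theta = P], [X_+ Theta = (As + Bs K) P] and [U_- Theta = K P]. *)
  exists (G *m P); rewrite -trmx_mul !mulmxA XG UG XpG mul1mx.
  split; last by rewrite mulmxK ?posdef_unitmx.
  by split; [rewrite Ppd.1 | apply/posdef_block_lyapunov => //; exact: Ppd.1].
set P := Xminus x *m Theta in Psym Bpd KE.
have Ppd : posdef P := posdef_ulblock Bpd.
(* Because [U_- Theta = K P], this holds for every consistent [(A, B)], so the same [P] certifies
   all closed loops at once. *)
have XpT : Xplus x *m Theta = (A + B *m K) *m P.
  rewrite AB /= -mulmxA mul_col_mx mul_row_col mulmxDl -/P KE -!mulmxA.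
  by rewrite mulVmx ?mulmx1 ?posdef_unitmx.
rewrite -trmx_mul XpT in Bpd.
by have [//|_ Spd] := (posdef_block_lyapunov _ _).1 Bpd; apply: lyapunov_stable Spd.
Qed.

Theorem theorem17 (R : realType) (n m q : nat) (T : 'I_q -> nat)
    (n_gt0 : (0 < n)%N) (m_gt0 : (0 < m)%N) (q_gt0 : (0 < q)%N)
    (T_gt0 : forall i : 'I_q, (0 < T i)%N)
    (As : 'M[R]_n) (Bs : 'M[R]_(n, m))
    (u : inputs R m T) (x : states R n T)
    (data_ux : generated_by As Bs u x) :
  (informative_state_feedback u x <->
     exists Theta : 'M[R]_(\sum_(i < q) T i, n), feedback_lmi x Theta) /\
  (forall K : 'M[R]_(m, n),
     Sigma_is u x `<=` Sigma_K K <->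
     exists Theta : 'M[R]_(\sum_(i < q) T i, n),
       feedback_lmi x Theta /\
       K = Uminus u *m Theta *m invmx (Xminus x *m Theta)).
Proof.
have KP K := Sigma_K_lmi K n_gt0 data_ux.
split=> //; split=> [[K /KP[Theta [lmi _]]]|[Theta lmi]]; first by exists Theta.
by exists (Uminus u *m Theta *m invmx (Xminus x *m Theta)); apply/KP; exists Theta.
Qed.
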